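(* Consider the Lipschitz MAB problem on a metric space $(L,X)$ and let $\mathcal{A}$ be the zooming algorithm. Then for every problem instance and every $C>0$, if $d$ is the $C$-zooming dimension of the instance, then $R_{\mathcal{A}}(t)\le O\big((C\log t)^{1/(2+d)}\big)\, t^{1-1/(2+d)}$ for all $t\ge 2$, where the constant in $O(\cdot)$ is absolute.
   Context: Lipschitz MAB problem on a metric space $(L,X)$ of diameter $\le1$: unknown payoff $\mu:X\to[0,1]$ with $|\mu(x)-\mu(y)|\le L(x,y)$; playing $x$ yields an independent sample from a distribution on $[0,1]$ with mean $\mu(x)$. $\mu^*=\sup_X\mu$, $\Delta(v)=\mu^*-\mu(v)$. Regret $R_{\mathcal{A}}(t)=t\mu^*-W_{\mathcal{A}}(t)$, $W_{\mathcal{A}}(t)$ expected total payoff of the first $t$ rounds. $B(x,r)$ is the open ball. Zooming algorithm: it runs in phases $i=1,2,\dots$, phase $i$ lasting $2^i$ rounds and being independent of earlier phases. Within phase $i$, for $v\in X$ and round $t$ of the phase, $n_t(v)$ is the number of times $v$ was played in this phase before $t$, $\mu_t(v)$ the average of the corresponding rewards ($0$ if $n_t(v)=0$), the confidence radius is $r_t(v)=\sqrt{8i/(2+n_t(v))}$ and the index is $I_t(v)=\mu_t(v)+2r_t(v)$. At the start of a phase no strategy is active. A strategy $u$ is covered at time $t$ if $u\in B(v,r_t(v))$ for some active $v$. In each round: (1) if some strategy is not covered, one such strategy is made active; (2) an active strategy with maximal index is played (ties broken arbitrarily). $C$-zooming dimension of an instance: the smallest $d$ such that for every $r\in(0,1]$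 the set $X_r=\{x\in X: r/2<\mu^*-\mu(x)\le r\}$ can be covered by $C\,r^{-d}$ sets of diameter at most $r/8$.
   Formalization: The zooming dimension is taken as the smallest d ≥ 0 (with negative d the claim can fail, e.g. two strategies with gap 1/2, C=2, d=-1, or no smallest d exists), and the activation and tie-breaking choices are assumed to make the expected payoffs measurable in the rewards. *)

(* Defs.v *)
From HB Require Import structures.
From mathcomp Require Import all_boot all_order all_algebra.
From mathcomp Require Import all_classical all_reals all_analysis measurable_realfun.
Set Implicit Arguments. Unset Strict Implicit. Unset Printing Implicit Defensive.
Import Order.TTheory GRing.Theory Num.Theory.
Import numFieldNormedType.Exports.
Local Open Scope classical_set_scope.
Local Open Scope ring_scope.

Section LipschitzMAB.
Variables (R : realType) (X : Type) (L : X -> X -> R).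

Definition is_metric : Prop :=
  (forall x y, 0 <= L x y) /\ (forall x y, L x y = 0 <-> x = y) /\
  (forall x y, L x y = L y x) /\ (forall x y z, L x z <= L x y + L y z).

Variable mu : X -> R.

Definition mustar : R := sup (range mu).

Definition Xr (r : R) : set X := [set x | r / 2 < mustar - mu x <= r].

Definition zoom_cover (C d : R) : Prop :=
  forall r : R, 0 < r <= 1 ->
    exists N : nat, N%:R <= C * r `^ (- d) /\
      exists S : nat -> set X,
        (forall k, (k < N)%N -> forall x y, S k x -> S k y -> L x y <= r / 8) /\
        Xr r `<=` \bigcup_(k in [set k | (k < N)%N]) S k.

Definition is_zooming_dim (C d : R) : Prop :=
  0 <= d /\ zoom_cover C d /\ (forall d', 0 <= d' -> zoom_cover C d' -> d <= d').

(** One round of a phase: (strategy activated in step (1), if any;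
    strategy played in step (2); reward observed). *)
Definition event := (option X * X * R)%type.

Definition nplays (h : seq event) (v : X) : nat :=
  count (fun e : event => `[< e.1.2 = v >]) h.

Definition avgrew (h : seq event) (v : X) : R :=
  if nplays h v == 0%N then 0
  else (\sum_(e <- h | `[< e.1.2 = v >]) e.2) / (nplays h v)%:R.

Definition rad (i : nat) (h : seq event) (v : X) : R :=
  Num.sqrt (8 * i%:R / (2 + (nplays h v)%:R)).

Definition zindex (i : nat) (h : seq event) (v : X) : R :=
  avgrew h v + 2 * rad i h v.

Definition active (h : seq event) (v : X) : Prop :=
  has (fun e : event => `[< e.1.1 = Some v >]) h.

Definition covered (i : nat) (h : seq event) (u : X) : Prop :=
  exists v, active h v /\ L v u < rad i h v.

(** Rules resolving the arbitrary choices of the algorithm: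
    [act i h] = the uncovered strategy to activate, [pick i h] = the
    active strategy (of maximal index) to play, as functions of the
    phase number and of the history of the current phase. *)
Variables (act pick : nat -> seq event -> X).

Definition activation (i : nat) (h : seq event) : option X :=
  if `[< exists u, ~ covered i h u >] then Some (act i h) else None.

Definition active_after (i : nat) (h : seq event) (v : X) : Prop :=
  active h v \/ activation i h = Some v.

Definition act_valid : Prop :=
  forall i h, (exists u, ~ covered i h u) -> ~ covered i h (act i h).

Definition pick_valid : Prop :=
  forall i h, (exists v, active_after i h v) ->
    active_after i h (pick i h) /\
    forall v, active_after i h v -> zindex i h v <= zindex i h (pick i h).

(** Reward distributions: nu x is a probability distribution (on R, supported
    on [0,1]) whose samples are the rewards of playing x. *)
Variable nu : X -> probability R R.

Local Open Scope ereal_scope.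

(** Expected total payoff of the remaining [m] rounds of phase [i], given the
    history [h] of the phase so far; each round's reward is an independent
    sample from nu of the strategy played. *)
Fixpoint phase_payoff (i : nat) (h : seq event) (m : nat) : \bar R :=
  match m with
  | 0%N => 0
  | m'.+1 =>
      \int[nu (pick i h)]_(r in setT)
         (r%:E + phase_payoff i (rcons h (activation i h, pick i h, r)) m')
  end.

(** Well-definedness of the expectations (measurability in the new reward). *)
Definition payoff_measurable : Prop :=
  forall i h m, measurable_fun setT
    (fun r : R => phase_payoff i (rcons h (activation i h, pick i h, r)) m).

(** Phase i (i >= 1) lasts 2^i rounds and starts after 2^i - 2 rounds;
    number of rounds of phase i among the first t rounds: *)
Definition phase_len (t i : nat) : nat := minn (2 ^ i) (t - (2 ^ i - 2)).

(** W_A(t): expected total payoff of the first t rounds (phases are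
    independent fresh runs). *)
Definition total_payoff (t : nat) : \bar R :=
  \sum_(1 <= i < t.+2) phase_payoff i [::] (phase_len t i).

Definition regret (t : nat) : \bar R := (t%:R * mustar)%:E - total_payoff t.

End LipschitzMAB.

(* Main.v *)
(** Call a history clean if every empirical mean lies within its confidence
    radius.  After each activation every strategy is covered, so on clean
    histories the index of the played strategy is at least [mustar]; hence its
    gap is at most three radii, and a strategy of gap [g] is played at most
    [O(i / g^2)] times in phase [i].  Since a strategy is activated only when it
    is uncovered, active strategies with gaps in [(r/2, r]] are more than [r/8]
    apart, so there are at most [C r^-d] of them.  Summing over dyadic [r] down
    to [rho] bounds the regret of a phase of length [T] by
    [rho T + O(i C rho^-(d+1))], optimized at [rho = (C i / T)^(1/(2+d))].

    The choice rules [act] and [pick] need not be measurable, so the probability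
    of leaving the clean histories is not a usable object.  Instead, the expected
    payoff is bounded from below by backward induction, with a potential that
    sums, over the played strategies [v] and over tilts [c], the martingales
    [\prod (1 + c (r_j - mu v))].  The potential is affine in the next reward,
    and [1 + x >= exp(x - x^2)] makes it exponentially large in [i] as soon as
    the history is not clean.  The loss on unclean histories is proportional to
    the largest gap, which is at most [C^(1/(2+d))]; this makes the constant
    absolute also for small [C]. *)
Require Import Defs.
From HB Require Import structures.
From mathcomp Require Import all_boot all_order all_algebra.
From mathcomp Require Import all_classical all_reals all_analysis measurable_realfun.
From mathcomp Require Import ring lra zify.
Import Order.TTheory GRing.Theory Num.Theory.
Import numFieldNormedType.Exports.
Local Open Scope classical_set_scope.
Local Open Scope ring_scope.

(** * Elementary estimates *)

(** The quotient of 1 + y by exp(y - y^2) has a derivative of the sign of y (1 + 2 y), so its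
    minimum over y >= -1/2 is the value 1 at y = 0. *)
Lemma expR_subsqr_le {R : realType} (x : R) :
  - 2^-1 <= x -> expR (x - x ^+ 2) <= 1 + x.
Proof.
move=> xge.
pose f (y : R) := (1 + y) * expR (y ^+ 2 - y).
pose f' (y : R) := y * (1 + 2 * y) * expR (y ^+ 2 - y).
have df (y : R) : is_derive y 1 f (f' y).
  apply: is_derive_eq; rewrite /GRing.scale /= /f'.
  ring.
have cf : continuous f.
  by move=> y; apply/differentiable_continuous/derivable1_diffP; case: (df y).
have f0 : f 0 = 1 by rewrite /f expr0n /= subr0 expR0 addr0 mulr1.
have fx : 1 <= f x.
  rewrite -f0; have [x0|x0|->] := ltrgtP x 0; last exact: lexx.
  - have [c /[!in_itv]/= /andP[xc c0]] :=
      MVT x0 (fun y _ => df y) (continuous_subspaceT cf).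
    rewrite -subr_le0 => ->.
    rewrite mulr_le0_ge0 ?subr_ge0 ?(ltW x0)//.
    by rewrite /f' mulr_le0_ge0 ?expR_ge0// mulr_le0_ge0//; lra.
  - have [c /[!in_itv]/= /andP[xc c0]] :=
      MVT x0 (fun y _ => df y) (continuous_subspaceT cf).
    rewrite -subr_ge0 => ->.
    rewrite mulr_ge0 ?subr_ge0 ?(ltW x0)//.
    by rewrite /f' mulr_ge0 ?expR_ge0// mulr_ge0//; lra.
have -> : x - x ^+ 2 = - (x ^+ 2 - x) by ring.
by rewrite expRN -[leLHS]mul1r ler_pdivrMr ?expR_gt0.
Qed.

Lemma expR_half_le2 {R : realType} : expR 2^-1 <= 2 :> R.
Proof.
have := expR_ge1Dx (- 2^-1 : R); rewrite expRN => h.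
rewrite -[leRHS]invrK -[leLHS]invrK lef_pV2 ?posrE ?invr_gt0 ?expR_gt0//.
by apply: le_trans h; lra.
Qed.

Lemma powR_half {R : realType} (n : nat) (b : R) :
  (2^-1 ^+ n) `^ (- b) = (2 `^ b) ^+ n.
Proof.
rewrite powRN -[2^-1 ^+ n]powR_mulrn// powRAC powR_mulrn ?powR_ge0// -exprVn.
by rewrite -[2^-1]powR_inv1// -powRrM mulN1r powRN invrK.
Qed.

Lemma geometric_sum_le {R : realType} (a : R) (n : nat) :
  2 <= a -> \sum_(j < n.+1) a ^+ j <= 2 * a ^+ n.
Proof.
move=> a2; elim: n => [|n IH]; first by rewrite big_ord1 /= !expr0 mulr1 ler1n.
rewrite big_ord_recr/= exprS; apply: (le_trans (lerD IH (lexx _))).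
have : 0 <= a ^+ n * (a - 2) by rewrite mulr_ge0 ?exprn_ge0//; lra.
lra.
Qed.

(** * Integration over rewards in the unit interval *)

Section affine_minorant.
Set Implicit Arguments.
Unset Strict Implicit.
Context {R : realType} (P : probability R R).
Hypothesis P01 : P [set r | 0 <= r <= 1] = 1%E.

Let D := [set r : R | 0 <= r <= 1].

Let mD : measurable D.
Proof.
rewrite (_ : D = `[0, 1]%classic); first exact: measurable_itv.
by apply/seteqP; split=> r /=; rewrite in_itv.
Qed.

Let PC : P (~` D) = 0%E.
Proof. by rewrite probability_setC// P01 subee. Qed.

Lemma integral_unit_itv (F : R -> \bar R) : measurable_fun setT F ->
  (\int[P]_(r in setT) F r = \int[P]_(r in D) F r)%E.
Proof.
move=> mF; rewrite [RHS]integral_mkcond; apply: ae_eq_integral => //.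
  apply/(measurable_restrictT _ mD).
  exact: measurable_funTS.
exists (~` D); split => //; first exact: measurableC.
move=> r /= h Dr; apply: h => _.
by rewrite patchE mem_set.
Qed.

(** [F] may fail to be integrable. Adding the constant |a| + |b| makes the affine function
    nonnegative on [0, 1] too, so monotonicity of the nonnegative integral applies. *)
Lemma le_integral_affine (F : R -> \bar R) (a b m : R) :
  measurable_fun setT F ->
  (\int[P]_(r in setT) r%:E = m%:E)%E ->
  (forall r, 0 <= r <= 1 -> (0 <= F r)%E) ->
  (forall r, 0 <= r <= 1 -> ((a + b * r)%:E <= F r)%E) ->
  ((a + b * m)%:E <= \int[P]_(r in setT) F r)%E.
Proof.
move=> mF; rewrite !integral_unit_itv //.
move=> Em F0 FG.
have PD : P D = 1%E by [].
have intc (k : R) : (\int[P]_(r in D) k%:E = k%:E)%E.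
  rewrite integral_cst//; transitivity (k%:E * 1)%E; last by rewrite mule1.
  by congr (_ * _)%E.
have mid : measurable_fun D (@EFin R).
  exact: EFin_measurable.
have iid : P.-integrable D (@EFin R).
  apply: (@le_integrable _ _ _ _ _ mD _ (cst 1%:E)) => //.
    move=> r /= /andP[r0 r1]; rewrite lee_fin ger0_norm// normr1; exact: r1.
  by apply/finite_measure_integrable_cst.
pose c := `|a| + `|b|.
have GcE : (\int[P]_(r in D) (c + a + b * r)%:E = (c + a + b * m)%:E)%E.
  under eq_integral do rewrite EFinD EFinM.
  rewrite integralD//; last 2 first.
  - exact: finite_measure_integrable_cst.
  - exact: integrableZl.
  by rewrite integralZl// Em intc.
have cge0 : 0 <= c by rewrite addr_ge0.
have le1 : ((c + a + b * m)%:E <= \int[P]_(r in D) (F r + c%:E))%E.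
  rewrite -GcE; apply: ge0_le_integral => //.
  - move=> r /andP[r0 r1]; rewrite lee_fin /c.
    have := ler_normlW (lexx `|a|); have := ler_norm (- a); rewrite normrN.
    have : `|b * r| <= `|b| by rewrite normrM ler_piMr// ger0_norm.
    have := ler_norm (- (b * r)); rewrite normrN; lra.
  - apply/measurable_EFinP; exact: measurable_funD.
  - apply: emeasurable_funD => //; exact: measurable_funTS.
  - by move=> r Dr; rewrite -[c + a + _]addrA [c + _]addrC EFinD leeD2rE// FG.
move: le1; rewrite ge0_integralD//; last exact: measurable_funTS.
by rewrite intc -[c + a + _]addrA [c + _]addrC EFinD leeD2rE.
Qed.

End affine_minorant.

(** * Regret of a clean phase *)

Section phase.
Set Implicit Arguments.
Unset Strict Implicit.
Context {R : realType} {X : Type}.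
Variables (L : X -> X -> R) (mu : X -> R).
Variables (act pick : nat -> seq (event R X) -> X).
Hypothesis metL : is_metric L.
Hypothesis diamL : forall x y, L x y <= 1.
Hypothesis mu01 : forall x, 0 <= mu x <= 1.
Hypothesis lipmu : forall x y, `|mu x - mu y| <= L x y.
Hypothesis actP : act_valid L act.
Hypothesis pickP : pick_valid L act pick.
Variable i : nat.
Hypothesis i_gt0 : (0 < i)%N.

Local Notation history := (seq (event R X)).
Local Notation rad := (Defs.rad i).
Local Notation gap x := (mustar mu - mu x).

Lemma mu_le_mustar x : mu x <= mustar mu.
Proof.
apply: sup_upper_bound; last by exists x.
split; first by exists (mu x), x.
by exists 1 => _ [y _ <-]; case/andP: (mu01 y).
Qed.

Lemma mustar_le (x : X) c : (forall y, mu y <= c) -> mustar mu <= c.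
Proof.
move=> muc; apply: ge_sup; first by exists (mu x), x.
by move=> _ [y _ <-].
Qed.

Lemma gap_ge0 x : 0 <= gap x. Proof. by rewrite subr_ge0 mu_le_mustar. Qed.

Lemma gap_le1 x : gap x <= 1.
Proof.
have h : mustar mu <= 1 by apply: (mustar_le x) => y; case/andP: (mu01 y).
have /andP[h0 _] := mu01 x; lra.
Qed.

Let i_ge1 : 1 <= i%:R :> R. Proof. by rewrite ler1n. Qed.

Lemma rad_sqr (h : history) v :
  rad h v ^+ 2 = 8 * i%:R / (2 + (nplays h v)%:R).
Proof. by rewrite sqr_sqrtr// divr_ge0// addr_ge0. Qed.

Lemma rad_gt0 (h : history) v : 0 < rad h v.
Proof.
rewrite sqrtr_gt0 divr_gt0// ?ltr_wpDr//.
by rewrite mulr_gt0// ltr0n.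
Qed.

Lemma rad_unplayed (h : history) v : nplays h v = 0%N -> 1 <= rad h v.
Proof.
move=> n0; have := rad_sqr h v; rewrite n0 addr0 => e.
have := rad_gt0 h v => r0; rewrite leNgt; apply/negP => r1.
have : rad h v ^+ 2 < 1 by rewrite expr_lt1// ltW.
rewrite e; have := i_ge1; lra.
Qed.

Definition clean (h : history) : Prop :=
  forall v, `|avgrew h v - mu v| <= rad h v.

(* All strict prefixes of a run are clean; the run itself need not be. *)
Inductive run : history -> Prop :=
| run_nil : run [::]
| run_rcons h r : run h -> clean h -> 0 <= r <= 1 ->
    run (rcons h (activation L act i h, pick i h, r)).

(** * Covering and separation of active strategies *)

Lemma nplays_rcons (h : history) e v :
  nplays (rcons h e) v = (nplays h v + `[< e.1.2 = v >])%N.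
Proof. by rewrite /nplays -cats1 count_cat /= addn0. Qed.

Lemma active_rcons (h : history) e v :
  active (rcons h e) v <-> e.1.1 = Some v \/ active h v.
Proof.
rewrite /active has_rcons; split.
  by move=> /orP[/asboolP|]; [left|right].
by move=> [/asboolP ->//|->]; rewrite orbT.
Qed.

Lemma activation_Some (h : history) v :
  activation L act i h = Some v -> ~ covered L i h v.
Proof.
rewrite /activation; case: asboolP => // hu [<-].
exact: actP.
Qed.

Lemma active_covered (h : history) v : active h v -> covered L i h v.
Proof.
move=> hv; exists v; split=> //.
have [_ [/(_ v v) [_ ->//] _]] := metL.
exact: rad_gt0.
Qed.

Lemma active_after_ex (h : history) : exists v, active_after L act i h v.
Proof.
have [hu|hu] := pselect (exists u, ~ covered L i h u).
  by exists (act i h); right; rewrite /activation; case: asboolP.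
have [v [av _]] : covered L i h (pick i h).
  by apply: contrapT => ?; apply: hu; exists (pick i h).
by exists v; left.
Qed.

Lemma pick_active (h : history) : active_after L act i h (pick i h).
Proof. by case: (pickP (active_after_ex h)). Qed.

Lemma played_active h v : run h -> (0 < nplays h v)%N -> active h v.
Proof.
elim=> [//|{}h r _ IH _ _]; rewrite nplays_rcons active_rcons /=.
case: asboolP => [<- _|_]; last by rewrite addn0; right; apply: IH.
by have [] := pick_active h; [right|left].
Qed.

(** A freshly activated strategy was uncovered, hence inactive, hence unplayed. Its radius is then
    at least 1, the bound on the diameter, so one activation restores coverage by closed balls. *)
Lemma cover_after h u : run h ->
  exists v, active_after L act i h v /\ L v u <= rad h v.
Proof.
move=> rh; have [hu|hu] := pselect (exists u, ~ covered L i h u).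
  have aE : activation L act i h = Some (act i h).
    by rewrite /activation; case: asboolP.
  exists (act i h); split; first by right.
  apply: (le_trans (diamL _ _)); apply: rad_unplayed; apply/eqP.
  rewrite -leqn0 leqNgt; apply/negP => /(played_active rh) /active_covered.
  exact: activation_Some.
have [v [av Lv]] : covered L i h u.
  by apply: contrapT => ?; apply: hu; exists u.
by exists v; split; [left|exact: ltW].
Qed.

Lemma pick_gap h : run h -> clean h -> gap (pick i h) <= 3 * rad h (pick i h).
Proof.
move=> rh ch.
have : mustar mu <= zindex i h (pick i h).
  apply: mustar_le => [|u]; first exact: (pick i h).
  have [v [av Lv]] := cover_after u rh.
  apply: le_trans ((pickP (active_after_ex h)).2 v av).
  have := lipmu v u; have := ch v; rewrite /zindex !ler_norml.
  by move=> /andP[? ?] /andP[? ?]; lra.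
have := ch (pick i h); rewrite /zindex ler_norml => /andP[? ?] ?; lra.
Qed.

(** Only the last play of [v] matters: the history before it was clean, so the gap is at most three
    radii, and 72 = 9 * 8. If n plays preceded it, the denominator 2 + n of the squared radius is
    the new count plus 1. *)
Lemma gap_sqr_nplays h v : run h ->
  gap v ^+ 2 * ((nplays h v)%:R + 1) <= 72 * i%:R.
Proof.
elim=> [|{}h r rh IH ch _].
  rewrite add0r mulr1; have : gap v ^+ 2 <= 1.
    by rewrite expr_le1// ?gap_ge0 ?gap_le1.
  have := i_ge1; lra.
rewrite nplays_rcons /=; case: asboolP => [<-|_]; last by rewrite addn0.
rewrite natrD; have := pick_gap rh ch; set p := pick i h => le_gap.
have : gap p ^+ 2 <= (3 * rad h p) ^+ 2.
  by rewrite ler_pXn2r// nnegrE ?gap_ge0// mulr_ge0// ltW// rad_gt0.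
rewrite exprMn rad_sqr; have n0 : 0 <= (nplays h p)%:R :> R by [].
set n := (nplays h p)%:R in n0 *.
rewrite mulrA ler_pdivlMr; last lra.
rewrite /=; lra.
Qed.

(** The factor 4 absorbs the mismatch between 2 + n in the squared radius and n + 1 in the play
    bound: 72 i + 1 < 128 i. *)
Lemma gap_lt_rad h v : run h -> gap v < 4 * rad h v.
Proof.
move=> rh; rewrite -(@ltr_pXn2r _ 2)// ?nnegrE ?gap_ge0//; last first.
  by rewrite mulr_ge0// ltW// rad_gt0.
rewrite exprMn rad_sqr mulrA ltr_pdivlMr; last by rewrite ltr_wpDr.
have := gap_sqr_nplays v rh; have := i_ge1.
have : gap v ^+ 2 <= 1 by rewrite expr_le1// ?gap_ge0 ?gap_le1.
case: (nplays h v) => [|n]; first lra.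
rewrite -natr1; have : 0 <= gap v ^+ 2 * n%:R by rewrite mulr_ge0// sqr_ge0.
lra.
Qed.

(** When the later of the two was activated, it lay outside the confidence ball of the earlier one,
    whose radius exceeded a quarter of its gap. The disjunction leaves open which came first. *)
Lemma active_separated h u v : run h -> active h u -> active h v -> u <> v ->
  gap u < 4 * L u v \/ gap v < 4 * L u v.
Proof.
have [_ [_ [Lsym _]]] := metL.
move=> rh; elim: rh u v => [//|{}h r rh IH ch _] u v.
have new w x : activation L act i h = Some w -> active h x ->
    gap x < 4 * L x w.
  move=> /activation_Some hw hx; apply: (lt_le_trans (gap_lt_rad x rh)).
  rewrite ler_pM2l//; rewrite leNgt; apply/negP => lt.
  by apply: hw; exists x.
move=> /active_rcons /= [hu|hu] /active_rcons /= [hv|hv] uv.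
- by move: hu hv uv => -> [].
- by right; rewrite Lsym; apply: new.
- by left; apply: new.
- exact: IH.
Qed.

(** * Regret by strategy and by dyadic scale of the gap *)

Let arms (h : history) : seq {classic X} := [seq e.1.2 | e <- h].

Lemma nplays_count (h : history) v :
  nplays h v = count_mem (v : {classic X}) (arms h).
Proof.
rewrite /nplays count_map; apply: eq_count => e /=.
by apply/asboolP/eqP.
Qed.

Lemma sum_by_arm (P : pred {classic X}) (F : X -> R) (h : history) :
  \sum_(e <- h | P e.1.2) F e.1.2 =
  \sum_(v <- undup (arms h) | P v) F v * (nplays h v)%:R.
Proof.
rewrite -(big_map (fun e : event R X => e.1.2 : {classic X}) P F).
rewrite -big_undup_iterop_count; apply: eq_bigr => v _.
rewrite nplays_count mulr_natr Monoid.iteropE.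
by elim: (count _ _) => //= n ->; rewrite mulrS.
Qed.

Lemma mem_arms h (v : {classic X}) : v \in arms h -> (0 < nplays h v)%N.
Proof. by rewrite nplays_count -has_count has_pred1. Qed.

(** Sending each played strategy to a cell containing it is injective: gaps above r/2 force
    distances above r/8, the bound on the diameter of a cell. *)
Lemma size_played_Xr h r N (S : nat -> set X) : run h ->
  (forall k, (k < N)%N -> forall x y, S k x -> S k y -> L x y <= r / 8) ->
  Xr mu r `<=` \bigcup_(k in [set k | (k < N)%N]) S k ->
  (size [seq v : {classic X} <- undup (arms h) | `[< Xr mu r v >]] <= N)%N.
Proof.
move=> rh Sdiam Scov; set s : seq {classic X} := [seq v <- _ | _].
have sP (v : {classic X}) : v \in s -> Xr mu r v /\ active h v.
  rewrite mem_filter mem_undup => /andP[/asboolP ? /mem_arms].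
  by move=> /(played_active rh).
have /choice [f fP] : forall v : {classic X},
    exists k, Xr mu r v -> (k < N)%N /\ S k v.
  move=> v; have [/Scov [k kN kv]|?] := pselect (Xr mu r v).
    by exists k.
  by exists 0%N.
rewrite -(size_map (f : {classic X} -> nat)) -[leqRHS](size_iota 0).
apply: uniq_leq_size; last first.
  move=> k kf; have [v vs ->] := mapP kf.
  have [vX _] := sP v vs; have [fv _] := fP v vX.
  by rewrite mem_iota add0n.
rewrite map_inj_in_uniq ?filter_uniq ?undup_uniq//.
move=> u v /sP [uX au] /sP [vX av] fuv.
apply: contrapT => uv.
have [uN Su] := fP u uX; have [_ Sv] := fP v vX.
have := Sdiam _ uN u v Su; rewrite fuv => /(_ Sv) Luv.
move: uX vX => /andP[? ?] /andP[? ?].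
by have [] := active_separated rh au av uv; lra.
Qed.

Variables (C d : R).
Hypothesis C_gt0 : 0 < C.
Hypothesis d_ge0 : 0 <= d.
Hypothesis coverC : zoom_cover L mu C d.

Lemma sum_gap_Xr h r : run h -> 0 < r <= 1 ->
  \sum_(e <- h | `[< Xr mu r e.1.2 >]) gap e.1.2 <=
  144 * i%:R * C * r `^ (- (d + 1)).
Proof.
move=> rh /[dup] r01 /andP[r0 _]; have [N [NC [S [Sdiam Scov]]]] := coverC r01.
rewrite (sum_by_arm (fun v => `[< Xr mu r v >]) (fun v => gap v)).
(* With gap g and n plays, g^2 n <= 72 i and g > r/2 give g n <= 144 i / r. *)
have le1 v : Xr mu r v -> gap v * (nplays h v)%:R <= 144 * i%:R / r.
  move=> /andP[v1 v2]; rewrite ler_pdivlMr//.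
  have := gap_sqr_nplays v rh.
  have : 0 <= gap v * (nplays h v)%:R by rewrite mulr_ge0// gap_ge0.
  have : 0 <= gap v ^+ 2 by exact: sqr_ge0.
  set n := (nplays h v)%:R; set g := gap v in v1 v2 * => g2 gn.
  have : 0 <= (g * n) * (2 * g - r) by rewrite mulr_ge0//; lra.
  have -> : g * n * (2 * g - r) = 2 * (g ^+ 2 * n) - g * n * r by ring.
  lra.
apply: (@le_trans _ _
  (\sum_(v <- undup (arms h) | `[< Xr mu r v >]) 144 * i%:R / r)).
  by apply: ler_sum => v /asboolP; exact: le1.
rewrite big_const_seq iter_addr addr0 -size_filter.
rewrite -[leLHS]mulr_natr.
have := size_played_Xr rh Sdiam Scov; rewrite -(ler_nat R) => sN.
have rE : r `^ (- (d + 1)) = r `^ (- d) / r.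
  rewrite opprD powRD ?powRN; last by rewrite (gt_eqF r0) implybT.
  by rewrite powRr1// ltW.
have c0 : 0 <= 144 * i%:R / r by rewrite divr_ge0// ?(ltW r0)// mulr_ge0.
apply: (le_trans (ler_wpM2l c0 (le_trans sN NC))).
rewrite rE le_eqVlt; apply/orP; left; apply/eqP.
by field; rewrite gt_eqF.
Qed.

Lemma sum_gap_dyadic h J : run h ->
  \sum_(e <- h | 2^-1 ^+ J < gap e.1.2) gap e.1.2 <=
  144 * i%:R * C * \sum_(j < J) (2 `^ (d + 1)) ^+ j.
Proof.
move=> rh; elim: J => [|J IH].
  rewrite big_ord0 mulr0 big1// => e; rewrite expr0 ltNge.
  by rewrite gap_le1.
rewrite big_ord_recr/= mulrDr.
have p0 : 0 < 2^-1 ^+ J :> R by rewrite exprn_gt0.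
have p1 : 0 < (2^-1 : R) ^+ J <= 1.
  by rewrite p0 exprn_ile1 ?invr_ge0//; lra.
rewrite -powR_half; apply: le_trans (lerD IH (sum_gap_Xr rh p1)).
rewrite (bigID (fun e : event R X => 2^-1 ^+ J < gap e.1.2)) /=.
apply: lerD.
  rewrite le_eqVlt; apply/orP; left; apply/eqP; apply: eq_bigl => e.
  apply/andb_idl => h1; apply: le_lt_trans h1.
  by rewrite exprS ler_piMl ?(ltW p0)//; lra.
rewrite le_eqVlt; apply/orP; left; apply/eqP; apply: eq_bigl => e.
rewrite -leNgt; apply/idP/asboolP; rewrite /Xr /= exprS mulrC => //.
Qed.

Lemma regret_le h rho : run h -> 0 < rho ->
  \sum_(e <- h) gap e.1.2 <=
  rho * (size h)%:R + 288 * i%:R * C * rho `^ (- (d + 1)).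
Proof.
move=> rh rho0.
have iC0 : 0 <= i%:R * C by rewrite mulr_ge0// ltW.
have size_le (P : pred X) : (forall x, P x -> gap x <= rho) ->
    \sum_(e <- h | P e.1.2) gap e.1.2 <= rho * (size h)%:R.
  move=> Prho; apply: (@le_trans _ _ (\sum_(e <- h) rho)).
    rewrite big_mkcond /=; apply: ler_sum => e _.
    by case: ifP => [/Prho//|_]; exact: ltW.
  by rewrite big_const_seq iter_addr addr0 count_predT mulr_natr.
have exJ : exists J, 2^-1 ^+ J <= rho.
  exists (Num.bound rho^-1); rewrite exprVn -[leRHS]invrK.
  rewrite lef_pV2 ?posrE ?invr_gt0 ?exprn_gt0//.
  have := archi_boundP (ltW (_ : 0 < rho^-1)).
  rewrite invr_gt0 => /(_ rho0) /ltW.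
  by move=> /le_trans; apply; rewrite -natrX ler_nat ltnW// ltn_expl.
(* If the least exponent is 0, all gaps are at most 1 <= rho. Otherwise the preceding scale exceeds
   rho, so the last term of the geometric sum, of ratio 2^(d+1) >= 2, is at most rho^-(d+1). The
   whole sum is at most twice that, whence 288 = 2 * 144. *)
case: (ex_minnP exJ) => -[|J] hJ minJ.
  rewrite -[leLHS]addr0 lerD//; last first.
    by rewrite !mulr_ge0 ?powR_ge0// ltW.
  by apply: (size_le predT) => x _; apply: le_trans hJ; rewrite expr0 gap_le1.
have rhoJ : rho < 2^-1 ^+ J.
  by rewrite ltNge; apply/negP => /minJ; rewrite ltnn.
rewrite (bigID (fun e : event R X => gap e.1.2 <= rho)) /=.
apply: lerD; first exact: (size_le (fun x => gap x <= rho)).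
pose a : R := 2 `^ (d + 1); have a2 : 2 <= a.
  by rewrite -[leLHS]powRr1//; apply: ler_powR; rewrite ?ler1n// lerDr.
have aJ : a ^+ J <= rho `^ (- (d + 1)).
  rewrite /a -powR_half !powRN lef_pV2 ?posrE ?powR_gt0// ?exprn_gt0//.
  apply: ge0_ler_powR; rewrite ?nnegrE ?(ltW rho0) ?exprn_ge0//;
    last exact: ltW.
  by rewrite addr_ge0.
have step := sum_gap_dyadic J.+1 rh.
apply: (@le_trans _ _ (\sum_(e <- h | 2^-1 ^+ J.+1 < gap e.1.2) gap e.1.2)).
  rewrite big_mkcond [leRHS]big_mkcond /=; apply: ler_sum => e _.
  rewrite -ltNge.
  case: ifPn => [h1|_]; first by rewrite (le_lt_trans hJ h1).
  by case: ifP => // _; rewrite gap_ge0.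
apply: (le_trans step).
have -> : 288 * i%:R * C * rho `^ (- (d + 1)) =
  144 * i%:R * C * (2 * rho `^ (- (d + 1))) by ring.
apply: ler_wpM2l; first by rewrite -mulrA mulr_ge0.
by apply: (le_trans (geometric_sum_le _ _ a2)); rewrite ler_wpM2l.
Qed.

(** * Expected payoff of a phase *)

Variable nu : X -> probability R R.
Hypothesis nu01 : forall x, nu x [set r | 0 <= r <= 1] = 1%E.
Hypothesis nu_mean : forall x, (\int[nu x]_(r in setT) r%:E = (mu x)%:E)%E.
Hypothesis measV : payoff_measurable L act pick nu.

Local Notation payoff := (phase_payoff L act pick nu i).
Local Notation next h r := (rcons h (activation L act i h, pick i h, r)).

Let meas_step h m :
  measurable_fun setT (fun r : R => (r%:E + payoff (next h r) m)%E).
Proof. by apply: emeasurable_funD; [exact: EFin_measurable|exact: measV]. Qed.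

Lemma payoff_ge0 h m : (0 <= payoff h m)%E.
Proof.
elim: m h => [//|m IH] h /=; rewrite (integral_unit_itv (nu01 _)) //.
by apply: integral_ge0 => r /andP[r0 _]; rewrite adde_ge0// lee_fin.
Qed.

(** A bound affine in the next reward integrates to its value at the mean, whatever the
    distribution. *)
Lemma payoff_step h m a b :
  (forall r, 0 <= r <= 1 -> ((a + b * r)%:E <= r%:E + payoff (next h r) m)%E) ->
  ((a + b * mu (pick i h))%:E <= payoff h m.+1)%E.
Proof.
move=> H /=; apply: (le_integral_affine (nu01 _)) => //.
by move=> r /andP[r0 _]; rewrite adde_ge0// ?lee_fin// payoff_ge0.
Qed.

Variable D : R.
Hypothesis gapD : forall x, gap x <= D.

Let D_ge0 : 0 <= D.
Proof. exact: le_trans (gap_ge0 _) (gapD (pick i [::])). Qed.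

(** Crude bound for continuing from an unclean history: a round loses at most [D]. *)
Lemma payoff_ge h m : ((m%:R * (mustar mu - D))%:E <= payoff h m)%E.
Proof.
elim: m h => [|m IH] h; first by rewrite mul0r.
apply: (@le_trans _ _ (m%:R * (mustar mu - D) + 1 * mu (pick i h))%:E).
  by rewrite lee_fin -natr1; have := gapD (pick i h); lra.
apply: payoff_step => r _; rewrite mul1r addrC EFinD.
by apply: leeD2l; exact: IH.
Qed.

(** * The martingale potential *)

Definition mart (c : R) (h : history) v : R :=
  \prod_(e <- h | `[< e.1.2 = v >]) (1 + c * (e.2 - mu v)).

Definition dev (h : history) v : R :=
  \sum_(e <- h | `[< e.1.2 = v >]) (e.2 - mu v).

Lemma mart_rcons c (h : history) e v : mart c (rcons h e) v =
  mart c h v * (if `[< e.1.2 = v >] then 1 + c * (e.2 - mu v) else 1).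
Proof. exact: big_rcons. Qed.

Lemma dev_rcons (h : history) e v : dev (rcons h e) v =
  dev h v + (if `[< e.1.2 = v >] then e.2 - mu v else 0).
Proof. exact: big_rcons. Qed.

Let abs_dev1 r v : 0 <= r <= 1 -> -1 <= r - mu v <= 1.
Proof. by move=> /andP[? ?]; have /andP[? ?] := mu01 v; lra. Qed.

Lemma norm_dev_le h v : run h -> `|dev h v| <= (nplays h v)%:R.
Proof.
elim=> [|{}h r _ IH _ r01]; first by rewrite /dev big_nil normr0.
rewrite dev_rcons nplays_rcons natrD; apply: le_trans (ler_normD _ _) _.
apply: lerD => //=; case: asboolP => _; last by rewrite normr0.
by rewrite ler_norml abs_dev1.
Qed.

(** Multiply 1 + x >= exp(x - x^2) over the plays of [v], where x = c (r - mu v). Rewards and means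
    in [0, 1] give |x| <= |c| <= 1/2. *)
Lemma mart_ge h v c : run h -> - 2^-1 <= c <= 2^-1 ->
  expR (c * dev h v - c ^+ 2 * (nplays h v)%:R) <= mart c h v.
Proof.
move=> rh c2; elim: rh => [|{}h r _ IH _ r01].
  by rewrite /mart /dev !big_nil /nplays /= !mulr0 subr0 expR0.
rewrite mart_rcons dev_rcons nplays_rcons /=; case: asboolP => _; last first.
  by rewrite addr0 addn0 mulr1.
set x := c * (r - mu v).
have /andP[y1 y2] := abs_dev1 v r01; have /andP[c1 c3] := c2.
set y := r - mu v in x y1 y2 *.
have x2 : - 2^-1 <= x.
  have : 0 <= (2^-1 + c) * (1 + y) by rewrite mulr_ge0//; lra.
  have : 0 <= (2^-1 - c) * (1 - y) by rewrite mulr_ge0//; lra.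
  rewrite /x; lra.
have xc : x ^+ 2 <= c ^+ 2.
  rewrite /x exprMn ler_piMr ?sqr_ge0// -ler_sqrt// sqrtr1 sqrtr_sqr.
  by rewrite ler_norml y1 y2.
apply: (@le_trans _ _
  (expR (c * dev h v - c ^+ 2 * (nplays h v)%:R) * expR (x - x ^+ 2))).
  rewrite -expRD ler_expR natrD mulr1n /x; move: xc; rewrite /x; lra.
by rewrite ler_pM ?expR_ge0// expR_subsqr_le.
Qed.

Lemma mart_ge0 h v c : run h -> - 2^-1 <= c <= 2^-1 -> 0 <= mart c h v.
Proof. by move=> rh /(mart_ge v rh); apply: le_trans; exact: expR_ge0. Qed.

Definition pot (c : R) (h : history) (m : nat) : R :=
  \sum_(v <- undup (arms h)) mart c h v + m%:R.

(* In expectation over [r] the last term vanishes.  An arm played for the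
   first time enters the sum with weight [1], paid for by the decrease of [m]. *)
Lemma pot_rcons c (h : history) o x r m :
  pot c (rcons h (o, x, r)) m <=
  pot c h m.+1 + c * mart c h x * (r - mu x).
Proof.
rewrite /pot /arms map_rcons undup_rcons big_rcons /= mart_rcons /=.
case: asboolP => // _; rewrite big_filter.
under eq_bigr => v vx.
  rewrite mart_rcons /=; case: asboolP => [xv|_]; last rewrite mulr1.
    by move: vx; rewrite xv eqxx.
  over.
rewrite -natr1; have [xh|xh] := boolP ((x : {classic X}) \in undup (arms h)).
  by rewrite (bigD1_seq _ xh) ?undup_uniq//=; lra.
have -> : mart c h x = 1.
  rewrite /mart big_hasC// has_count -/(nplays h x) nplays_count.
  by rewrite -has_count has_pred1 -mem_undup.
rewrite (_ : \sum_(v <- undup (arms h) | v != x) _ =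
             \sum_(v <- undup (arms h)) mart c h v); first lra.
rewrite big_seq_cond [RHS]big_seq; apply: eq_bigl => v.
by apply: andb_idr => vh; apply: contraNneq xh => <-.
Qed.

Lemma pot_ge0 c h m : run h -> - 2^-1 <= c <= 2^-1 -> 0 <= pot c h m.
Proof.
by move=> rh c2; rewrite addr_ge0// sumr_ge0// => v _; exact: mart_ge0.
Qed.

Lemma mart_le_pot c h v m : run h -> - 2^-1 <= c <= 2^-1 ->
  (0 < nplays h v)%N -> mart c h v <= pot c h m.
Proof.
move=> rh c2; rewrite nplays_count -has_count has_pred1 => vh.
rewrite /pot (bigD1_seq (v : {classic X})) ?mem_undup ?undup_uniq//=.
by rewrite -addrA lerDl addr_ge0// sumr_ge0// => u _; exact: mart_ge0.
Qed.

(* Half the confidence radius after [k] plays: the exponent that optimizes the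
   deviation bound for an arm leaving its confidence interval at that time. *)
Definition tilt (k : nat) : R :=
  Num.min (Num.sqrt (8 * i%:R / (2 + k%:R))) 1 / 2.

Lemma tilt_bound k : 0 <= tilt k <= 2^-1.
Proof.
rewrite /tilt; set s := Num.sqrt _; have s0 : 0 <= s by exact: sqrtr_ge0.
by rewrite /Num.min; case: ltP => ?; lra.
Qed.

Let tiltP k : - 2^-1 <= tilt k <= 2^-1.
Proof. by have /andP[? ?] := tilt_bound k; lra. Qed.

Let tiltN k : - 2^-1 <= - tilt k <= 2^-1.
Proof. by have /andP[? ?] := tilt_bound k; lra. Qed.

Local Notation T := (2 ^ i)%N.

(** The two signs detect deviations in both directions. The index [k] runs over all play counts
    possible in a phase, as the count at which an arm leaves its interval is not known
    beforehand. *)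
Definition total_pot (h : history) (m : nat) : R :=
  \sum_(k < T.+1) (pot (tilt k) h m + pot (- tilt k) h m).

Lemma total_pot_ge0 h m : run h -> 0 <= total_pot h m.
Proof.
by move=> rh; apply: sumr_ge0 => k _; rewrite addr_ge0// pot_ge0.
Qed.

Lemma total_pot_rcons (h : history) o x r m :
  total_pot (rcons h (o, x, r)) m <= total_pot h m.+1 +
  (\sum_(k < T.+1) (tilt k * mart (tilt k) h x - tilt k * mart (- tilt k) h x))
  * (r - mu x).
Proof.
rewrite mulr_suml -big_split /=; apply: ler_sum => k _.
have := pot_rcons (tilt k) h o x r m; have := pot_rcons (- tilt k) h o x r m.
lra.
Qed.

Lemma dev_avgrew (h : history) v : (0 < nplays h v)%N ->
  dev h v = (nplays h v)%:R * (avgrew h v - mu v).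
Proof.
rewrite lt0n => n0; rewrite /dev big_split /= sumrN /avgrew (negbTE n0).
rewrite big_const_seq iter_addr addr0 -[count _ h]/(nplays h v).
rewrite -mulr_natr; field.
by rewrite pnatr_eq0.
Qed.

Lemma clean_unplayed (h : history) v : nplays h v = 0%N ->
  `|avgrew h v - mu v| <= rad h v.
Proof.
move=> n0; apply: le_trans (rad_unplayed n0).
rewrite /avgrew n0 eqxx sub0r normrN ger0_norm; by case/andP: (mu01 v).
Qed.

(** Take the term of the offending arm whose [k] is its play count n and whose sign is that of its
    deviation. For radius r the exponent is at least (r/2) n r - (r/2)^2 n = n r^2 / 4 = 2 i - r^2 /
    2, because r^2 (2 + n) = 8 i. *)
Lemma total_pot_unclean h m : run h -> (size h <= T)%N -> ~ clean h ->
  expR (2 * i%:R - 2^-1) <= total_pot h m.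
Proof.
move=> rh hT /asboolPn /existsp_asboolPn [v /negP]; rewrite -ltNge => dv.
have n0 : (0 < nplays h v)%N.
  rewrite lt0n; apply/eqP => /clean_unplayed; rewrite leNgt dv //.
have nT : (nplays h v < T.+1)%N by rewrite ltnS (leq_trans (count_size _ _)).
have n0R : 0 < (nplays h v)%:R :> R by rewrite ltr0n.
have devE := dev_avgrew n0.
(* A mean deviation is at most 1, so a violated radius is below 1 and the cap in [tilt] has no
   effect. *)
have rad1 : rad h v < 1.
  apply: lt_le_trans dv _; rewrite -(ler_pM2l n0R) mulr1.
  by have := norm_dev_le v rh; rewrite devE normrM ger0_norm// ltW.
have rad0 := rad_gt0 h v.
have tiltE : tilt (nplays h v) = rad h v / 2.
  by rewrite /tilt -[Num.sqrt _]/(rad h v) min_l// ltW.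
have key c x : `|c| = rad h v / 2 -> c * x = `|c| * `|x| ->
    x = avgrew h v - mu v ->
    2 * i%:R - 2^-1 <= c * dev h v - c ^+ 2 * (nplays h v)%:R.
  move=> cE cx xE; rewrite devE -xE mulrCA cx cE -real_normK ?num_real// cE xE.
  have := rad_sqr h v; move: dv rad0 rad1 n0R.
  set n := (nplays h v)%:R; set r := rad h v; set y := `|_| => dv r0 r1 n0R rE.
  have {rE} rE : r ^+ 2 * (2 + n) = 8 * i%:R by rewrite rE; field; lra.
  have : r ^+ 2 <= 1 by rewrite expr_le1// ltW.
  have : 0 <= n * r * (y - r) by rewrite mulr_ge0 ?mulr_ge0 ?subr_ge0// ltW.
  lra.
rewrite /total_pot (bigD1 (Ordinal nT)) //=.
rewrite -[leLHS]addr0; apply: lerD; last first.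
  by apply: sumr_ge0 => k _; rewrite addr_ge0// pot_ge0.
have rad2 : 0 <= rad h v / 2 by lra.
have [s|s] := leP 0 (avgrew h v - mu v).
- rewrite -[leLHS]addr0; apply: lerD; last exact: pot_ge0.
  apply: le_trans (mart_le_pot m rh (tiltP _) n0).
  apply: le_trans (mart_ge v rh (tiltP _)); rewrite ler_expR tiltE.
  by apply: (key _ (avgrew h v - mu v)); rewrite // ?ger0_norm.
- rewrite -[leLHS]add0r; apply: lerD; first exact: pot_ge0.
  apply: le_trans (mart_le_pot m rh (tiltN _) n0).
  apply: le_trans (mart_ge v rh (tiltN _)); rewrite ler_expR tiltE.
  apply: (key _ (avgrew h v - mu v)); rewrite // normrN ger0_norm//.
  by rewrite (ltr0_norm s); ring.
Qed.

(** * Backward induction over the rounds *)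

Variable B : R.
Hypothesis B_ge0 : 0 <= B.
Hypothesis regretB : forall h, run h -> (size h <= T)%N ->
  \sum_(e <- h) gap e.1.2 <= B.

(** Chosen so that on an unclean history [A] times the potential is at least D T, the most that a
    whole phase can lose. *)
Let A : R := D * T%:R * expR (2^-1 - 2 * i%:R).

Let A_ge0 : 0 <= A.
Proof. by rewrite !mulr_ge0// expR_ge0. Qed.

(** The remaining rounds may lose only the unspent part of the regret budget [B]. At the first
    unclean history the induction stops, and the potential pays for the crude bound [payoff_ge]. *)
Lemma payoff_run h m : run h -> clean h -> (size h + m <= T)%N ->
  ((m%:R * mustar mu - B + \sum_(e <- h) gap e.1.2 - A * total_pot h m)%:E
   <= payoff h m)%E.
Proof.
elim: m h => [|m IH] h rh ch hT.
  rewrite lee_fin mul0r; have := mulr_ge0 A_ge0 (total_pot_ge0 0 rh).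
  by rewrite addn0 in hT; have := regretB rh hT; lra.
set x := pick i h.
set b := \sum_(k < T.+1)
  (tilt k * mart (tilt k) h x - tilt k * mart (- tilt k) h x).
set Reg := \sum_(e <- h) gap e.1.2.
(* The bound to prove after reward [r] is affine with constant term [a] and slope 1 - A b. At the
   mean reward the terms in [b] cancel, which is the martingale property. *)
pose a := m%:R * mustar mu - B + Reg + gap x - A * total_pot h m.+1
  + A * b * mu x.
rewrite (_ : _ - _ = a + (1 - A * b) * mu x); last first.
  by rewrite /a -natr1; ring.
apply: payoff_step => r r01.
rewrite (_ : _ + _ = r + (m%:R * mustar mu - B + (Reg + gap x)
   - A * (total_pot h m.+1 + b * (r - mu x)))); last by rewrite /a; ring.
rewrite EFinD; apply: leeD2l.
have rn := run_rcons rh ch r01.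
have hT' : (size (next h r) + m <= T)%N by rewrite size_rcons addSnnS.
have RegE : \sum_(e <- next h r) gap e.1.2 = Reg + gap x by exact: big_rcons.
have Apot : A * total_pot (next h r) m <=
    A * (total_pot h m.+1 + b * (r - mu x)).
  by apply: ler_wpM2l => //; exact: total_pot_rcons.
have [cn|cn] := pselect (clean (next h r)).
  apply: le_trans (IH _ rn cn hT'); rewrite lee_fin RegE; lra.
apply: le_trans (payoff_ge _ _); rewrite lee_fin.
have sT : (size (next h r) <= T)%N by apply: leq_trans hT'; exact: leq_addr.
have : D * T%:R <= A * total_pot (next h r) m.
  rewrite /A -mulrA ler_peMr ?mulr_ge0//.
  apply: le_trans (ler_wpM2l (expR_ge0 _) (total_pot_unclean m rn sT cn)).
  by rewrite -expRD (_ : _ + _ = 0) ?expR0//; ring.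
have : Reg + gap x <= D * (size (next h r))%:R.
  rewrite -RegE; apply: (@le_trans _ _ (\sum_(e <- next h r) D)).
    by apply: ler_sum => e _.
  by rewrite big_const_seq iter_addr addr0 count_predT mulr_natr.
have : D * ((size (next h r))%:R + m%:R) <= D * T%:R.
  by rewrite ler_wpM2l// -natrD ler_nat.
move: (size _)%:R (T%:R) (total_pot (next h r) m) Apot => sz t P1; move: B_ge0.
move: (A * (_ + _)) => P2; move: m%:R => m' *; lra.
Qed.

Lemma payoff_nil m : (m <= T)%N ->
  ((m%:R * mustar mu - B - A * (2 * (T%:R + 1) * m%:R))%:E
   <= payoff [::] m)%E.
Proof.
move=> mT; have c0 : clean [::] by move=> v; exact: clean_unplayed.
have := @payoff_run [::] m run_nil c0 mT.
rewrite big_nil addr0 (_ : total_pot _ _ = 2 * (T%:R + 1) * m%:R)//.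
rewrite /total_pot (eq_bigr (fun=> 2 * m%:R)).
  by rewrite sumr_const card_ord -[LHS]mulr_natr -[T.+1]addn1 natrD; ring.
by move=> k _; rewrite /pot /= !big_nil; ring.
Qed.

End phase.

(** * Summation over the phases *)

Section phase_bound.
Set Implicit Arguments.
Unset Strict Implicit.
Context {R : realType} {X : Type}.
Variables (L : X -> X -> R) (mu : X -> R) (nu : X -> probability R R).
Variables (C d : R) (act pick : nat -> seq (event R X) -> X).
Hypothesis metL : is_metric L.
Hypothesis diamL : forall x y, L x y <= 1.
Hypothesis mu01 : forall x, 0 <= mu x <= 1.
Hypothesis lipmu : forall x y, `|mu x - mu y| <= L x y.
Hypothesis nu01 : forall x, nu x [set r | 0 <= r <= 1] = 1%E.
Hypothesis nu_mean : forall x, (\int[nu x]_(r in setT) r%:E = (mu x)%:E)%E.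
Hypothesis C_gt0 : 0 < C.
Hypothesis d_ge0 : 0 <= d.
Hypothesis coverC : zoom_cover L mu C d.
Hypothesis actP : act_valid L act.
Hypothesis pickP : pick_valid L act pick.
Hypothesis measV : payoff_measurable L act pick nu.

Local Notation gap x := (mustar mu - mu x).
Local Notation alpha := (1 / (2 + d)).

Let d2_gt0 : 0 < 2 + d. Proof. by rewrite ltr_wpDr. Qed.

Lemma alpha_gt0 : 0 < alpha.
Proof. by rewrite divr_gt0. Qed.

Lemma alpha_le_half : alpha <= 2^-1.
Proof. by rewrite div1r lef_pV2 ?posrE// lerDl. Qed.

(* The set [Xr (gap x)] contains [x], so its cover is nonempty: this is why
   small [C] forces small gaps. *)
Lemma gap_le_powR x : gap x <= C `^ alpha.
Proof.
have g0 := gap_ge0 mu01 x; have g1 := gap_le1 mu01 x.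
move: g0; rewrite le_eqVlt => /orP[/eqP <-|g0]; first exact: powR_ge0.
have r01 : 0 < gap x <= 1 by rewrite g0.
have [N [NC [S [_ Scov]]]] := coverC r01.
have N0 : (0 < N)%N.
  have [|k /= kN _] := Scov x; last exact: leq_ltn_trans kN.
  by rewrite /Xr /= lexx andbT; lra.
have gdC : gap x `^ d <= C.
  have : 1 <= C * gap x `^ (- d) by apply: le_trans NC; rewrite ler1n.
  by rewrite powRN ler_pdivlMr ?powR_gt0// mul1r.
have -> : gap x = (gap x `^ (2 + d)) `^ alpha.
  by rewrite -powRrM mulrC divfK ?gt_eqF// powRr1// ltW.
apply: ge0_ler_powR; rewrite ?nnegrE ?powR_ge0 ?(ltW alpha_gt0) ?(ltW C_gt0)//.
apply: le_trans gdC; rewrite powRD; last by rewrite (gt_eqF g0) implybT.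
by rewrite ler_piMl ?powR_ge0// powR_mulrn ?(ltW g0)// expr_le1// ltW.
Qed.

(** With T = 2^i this says T^3 exp(-2 i) <= sqrt T, which controls the loss on unclean histories.
    After squaring, each factor amounts to 32 <= exp 4, obtained from (5/4)^16 >= 32. *)
Lemma expR_phase_le i : (8 * expR (- 2)) ^+ i <= (2 ^+ i) `^ (2^-1) :> R.
Proof.
rewrite -[2 ^+ i]powR_mulrn// powRAC powR_mulrn ?powR_ge0//.
have [i0|i0] := posnP i; first by rewrite i0 !expr0.
rewrite ler_pXn2r// ?nnegrE ?powR_ge0 ?mulr_ge0 ?expR_ge0//.
rewrite -(@ler_pXn2r _ 2)// ?nnegrE ?powR_ge0 ?mulr_ge0 ?expR_ge0//.
rewrite -[leRHS]powR_mulrn ?powR_ge0// -powRrM mulVf// powRr1//.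
have e4 : 32 <= expR 4 :> R.
  apply: (@le_trans _ _ ((1 + 4^-1) ^+ 16)); first lra.
  apply: (@le_trans _ _ (expR 4^-1 ^+ 16)).
    by rewrite lerXn2r ?nnegrE ?expR_ge0 ?expR_ge1Dx// addr_ge0.
  rewrite -expRM_natl le_eqVlt; apply/orP; left; apply/eqP.
  by congr expR; field.
rewrite exprMn -expRM_natl (_ : 2 * - 2 = - 4 :> R); last by ring.
by rewrite expRN ler_pdivrMr ?expR_gt0//; lra.
Qed.

Lemma phase_payoff_ge i m : (0 < i)%N -> (m <= 2 ^ i)%N ->
  ((m%:R * mustar mu
    - 297 * ((C * i%:R) `^ alpha * (2 ^+ i) `^ (1 - alpha)))%:E
   <= phase_payoff L act pick nu i [::] m)%E.
Proof.
move=> i0 mT; set T : R := 2 ^+ i.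
have TE : (2 ^ i)%:R = T by rewrite natrX.
have T1 : 1 <= T by rewrite -TE ler1n expn_gt0.
have T0 : 0 < T by exact: lt_le_trans T1.
have i1 : 1 <= i%:R :> R by rewrite ler1n.
have Ci0 : 0 < C * i%:R by rewrite mulr_gt0// ltr0n.
set Z := (C * i%:R) `^ alpha * _.
(* This scale makes rho T and i C rho^-(d+1) both equal to [Z], so the clean regret is at most (1 +
   288) Z. *)
pose rho := (C * i%:R / T) `^ alpha.
have rho0 : 0 < rho by rewrite powR_gt0// divr_gt0.
have rhoT : rho * T = Z.
  rewrite /rho powRM ?(ltW Ci0) ?invr_ge0 ?(ltW T0)// /Z -mulrA; congr (_ * _).
  rewrite -powR_inv1 ?(ltW T0)// -powRrM mulN1r.
  rewrite -{2}[T]powRr1 ?(ltW T0)// -powRD 1?addrC//.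
  by rewrite (gt_eqF T0) implybT.
have rhoC : i%:R * C * rho `^ (- (d + 1)) = Z.
  rewrite -rhoT -[i%:R * C](_ : rho `^ (2 + d) * T = _); last first.
    rewrite /rho -powRrM divfK ?gt_eqF// powRr1
      ?divr_ge0 ?(ltW Ci0) ?(ltW T0)//.
    by rewrite divfK ?gt_eqF// mulrC.
  rewrite mulrAC -powRD; last by rewrite (gt_eqF rho0) implybT.
  by rewrite (_ : 2 + d - (d + 1) = 1) ?powRr1 ?(ltW rho0)//; ring.
have Z0 : 0 <= Z by rewrite mulr_ge0 ?powR_ge0.
have regB h : run L mu act pick i h -> (size h <= 2 ^ i)%N ->
    \sum_(e <- h) gap e.1.2 <= 289 * Z.
  move=> rh hT.
  have := regret_le metL diamL mu01 lipmu actP pickP i0 C_gt0 d_ge0 coverC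
    rh rho0.
  move=> /le_trans; apply.
  have : rho * (size h)%:R <= rho * T.
    by rewrite ler_wpM2l ?(ltW rho0)// -TE ler_nat.
  rewrite rhoT; have -> : 288 * i%:R * C * rho `^ (- (d + 1)) = 288 * Z.
    by rewrite -rhoC; ring.
  lra.
have B0 : 0 <= 289 * Z by rewrite mulr_ge0 ?ler0n.
have := payoff_nil mu01 i0 nu01 nu_mean measV
  gap_le_powR B0 regB mT.
apply: le_trans; rewrite lee_fin TE.
set D := C `^ alpha; have D0 : 0 <= D by exact: powR_ge0.
have mTR : m%:R <= T by rewrite -TE ler_nat.
have eE : expR (2^-1 - 2 * i%:R) = expR 2^-1 * expR (- 2) ^+ i :> R.
  by rewrite expRD -expRM_natl; congr (_ * expR _); ring.
have e12 := @expR_half_le2 R.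
(* Here i >= 1, and alpha <= 1/2 gives T^(1/2) <= T^(1 - alpha). *)
have DZ : D * T `^ (2^-1) <= Z.
  apply: ler_pM => //; first exact: powR_ge0.
    apply: ge0_ler_powR;
      rewrite ?nnegrE ?(ltW alpha_gt0) ?(ltW C_gt0) ?(ltW Ci0)//.
    by rewrite ler_peMr// ltW.
  by apply: ler_powR => //; have := alpha_le_half; lra.
have eT : T ^+ 3 * expR (- 2) ^+ i <= T `^ (2^-1).
  apply: le_trans (expR_phase_le i).
  rewrite exprMn le_eqVlt; apply/orP; left; apply/eqP.
  by rewrite /T -exprM mulnC exprM; congr (_ ^+ _ * _); ring.
(* The unclean loss costs 8 Z, from 2 (T + 1) m <= 4 T^2 and exp(1/2) <= 2; then 289 + 8 = 297. *)
suff : D * T * expR (2^-1 - 2 * i%:R) * (2 * (T + 1) * m%:R) <= 8 * Z by lra.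
rewrite eE; set e := expR 2^-1 in e12 *; set f := expR (- 2) ^+ i in eT *.
have e0 : 0 <= e by exact: expR_ge0.
have f0 : 0 <= f by rewrite exprn_ge0// expR_ge0.
apply: (@le_trans _ _ (4 * e * (D * (T ^+ 3 * f)))).
  have -> : 4 * e * (D * (T ^+ 3 * f)) = D * T * (e * f) * (4 * T * T) by ring.
  apply: ler_wpM2l; first by rewrite !mulr_ge0// ltW.
  by apply: ler_pM => //; [rewrite mulr_ge0// addr_ge0// ltW|lra].
apply: (@le_trans _ _ (8 * (D * T `^ (2^-1)))); last by rewrite ler_wpM2l.
apply: ler_pM; rewrite ?mulr_ge0// ?exprn_ge0 ?(ltW T0)//; first lra.
by rewrite ler_wpM2l.
Qed.

Lemma sum_phase_len t n :
  (\sum_(1 <= i < n.+1) phase_len t i = minn t (2 ^ n.+1 - 2))%N.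
Proof.
elim: n => [|n IH]; first by rewrite big_geq// minn0.
rewrite big_nat_recr//= IH /phase_len [(2 ^ n.+2)%N]expnS.
have : (2 <= 2 ^ n.+1)%N by rewrite expnS leq_pmulr// expn_gt0.
move: (2 ^ n.+1)%N => p p2; lia.
Qed.

(* The summand vanishes for the phases that start after round [t]. *)
Definition phase_growth (q : R) (t i : nat) : R :=
  if (2 ^ i < t.+2)%N then q ^+ i else 0.

(** A geometric sum of ratio q >= 4/3 is at most q / (q - 1) <= 4 times its last term, and [M]
    bounds the last nonzero term. *)
Lemma sum_phase_growth (q M : R) t n : 4 / 3 <= q -> 0 <= M ->
  (forall i, (2 ^ i < t.+2)%N -> q ^+ i <= M) ->
  \sum_(1 <= i < n.+1) phase_growth q t i <= 4 * M.
Proof.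
move=> q1 M0 qM.
have q0 : 0 <= q by lra.
have geo k : \sum_(1 <= i < k.+1) phase_growth q t i <= 4 * q ^+ k.
  elim: k => [|k IH]; first by rewrite big_geq// mulr_ge0// exprn_ge0.
  rewrite big_nat_recr//= exprS.
  have : phase_growth q t k.+1 <= q * q ^+ k.
    by rewrite /phase_growth -exprS; case: ifP => // _; rewrite exprn_ge0.
  have : 0 <= q ^+ k * (q - 4 / 3) by rewrite mulr_ge0 ?exprn_ge0 ?subr_ge0.
  lra.
elim: n => [|n IH]; first by rewrite big_geq// mulr_ge0.
have [nt|nt] := boolP (2 ^ n.+1 < t.+2)%N.
  by apply: le_trans (geo _) _; rewrite ler_wpM2l// qM.
by rewrite big_nat_recr//= {2}/phase_growth (negbTE nt) addr0.
Qed.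

Lemma regret_upper_bound t : (2 <= t)%N ->
  (regret L mu act pick nu t <=
   (9504 * (C * ln t%:R) `^ alpha * t%:R `^ (1 - alpha))%:E)%E.
Proof.
move=> t2; set Y := (C * ln t%:R) `^ alpha; pose q : R := 2 `^ (1 - alpha).
have a0 := alpha_gt0; have a1 := alpha_le_half.
have t2R : 2 <= t%:R :> R by rewrite ler_nat.
have t0 : 0 < t%:R :> R by lra.
have lnt0 : 0 <= ln (t%:R : R) by rewrite ln_ge0//; lra.
have Y0 : 0 <= Y by exact: powR_ge0.
have qE i : (2 ^+ i) `^ (1 - alpha) = q ^+ i.
  by rewrite -[2 ^+ i]powR_mulrn// powRAC powR_mulrn ?powR_ge0.
(* The hypothesis says that phase [i] starts within the first [t] rounds; then 2^i <= t + 1 <= 2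
   t. *)
have pow_le i : (2 ^ i < t.+2)%N -> 2 ^+ i <= 2 * t%:R :> R.
  rewrite ltnS => it; rewrite -natrX -natrM ler_nat; apply: leq_trans it _.
  by lia.
have ln2 : 2^-1 <= ln (2 : R).
  by rewrite -[leLHS]expRK ler_ln ?posrE ?expR_gt0// expR_half_le2.
(* From 2^i <= 2 t <= t^2 follows i ln 2 <= 2 ln t, and ln 2 >= 1/2. *)
have i_le i : (2 ^ i < t.+2)%N -> i%:R <= 4 * ln (t%:R : R).
  move=> /pow_le it.
  have : ln (2 ^+ i) <= ln (t%:R ^+ 2 : R).
    rewrite ler_ln ?posrE ?exprn_gt0//; apply: le_trans it _.
    by rewrite expr2 ler_wpM2r// ltW.
  rewrite !lnXn// -[ln 2 *+ i]mulr_natr.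
  have : 0 <= i%:R * (ln 2 - 2^-1) :> R by rewrite mulr_ge0// subr_ge0.
  lra.
(* Replacing [i] by 4 ln t costs a factor 4^alpha <= 4, and 1188 = 4 * 297. *)
have bound i : (0 < i)%N ->
    (((phase_len t i)%:R * mustar mu - 1188 * Y * phase_growth q t i)%:E
     <= phase_payoff L act pick nu i [::] (phase_len t i))%E.
  move=> i0; rewrite /phase_growth; case: ifPn => it; last first.
    have -> : phase_len t i = 0%N by rewrite /phase_len; lia.
    by rewrite mul0r mulr0 subr0.
  apply: le_trans (phase_payoff_ge i0 (geq_minl _ _)); rewrite lee_fin.
  rewrite lerD2l lerN2 qE mulrA -[1188 * Y * _]mulrA.
  have -> : 1188 * (Y * q ^+ i) = 297 * (4 * Y) * q ^+ i by ring.
  rewrite ler_wpM2r ?exprn_ge0 ?powR_ge0// ler_wpM2l ?ler0n//.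
  apply: (@le_trans _ _ ((4 * (C * ln t%:R)) `^ alpha)).
    apply: ge0_ler_powR; rewrite ?nnegrE ?(ltW a0) ?mulr_ge0 ?(ltW C_gt0)//.
    by rewrite mulrCA ler_wpM2l ?(ltW C_gt0)// i_le.
  rewrite powRM ?mulr_ge0 ?(ltW C_gt0)// ler_wpM2r//.
  rewrite -[leRHS]powRr1//; apply: ler_powR; last lra.
  by rewrite ler1n.
have growth : \sum_(1 <= i < t.+2) phase_growth q t i
    <= 4 * (2 * t%:R `^ (1 - alpha)).
  apply: sum_phase_growth; last first.
  - move=> i it; rewrite -qE.
    apply: (@le_trans _ _ ((2 * t%:R) `^ (1 - alpha))).
      apply: ge0_ler_powR; rewrite ?nnegrE ?exprn_ge0 ?mulr_ge0 ?pow_le//; lra.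
    rewrite powRM// ler_wpM2r ?powR_ge0//.
    by rewrite -[leRHS]powRr1//; apply: ler_powR; [rewrite ler1n|lra].
  - by rewrite mulr_ge0 ?powR_ge0.
  (* Since alpha <= 1/2, q is at least the square root of 2, which exceeds 4/3. *)
  - have q2 : 2 <= q ^+ 2.
      rewrite -powR_mulrn ?powR_ge0// -powRrM -[leLHS]powRr1//.
      by apply: ler_powR; [rewrite ler1n|lra].
    rewrite leNgt; apply/negP => q43.
    have : q ^+ 2 < (4 / 3) ^+ 2 by rewrite ltr_pXn2r ?nnegrE ?powR_ge0.
    lra.
have payoff_ge : ((t%:R * mustar mu - 9504 * Y * t%:R `^ (1 - alpha))%:E
    <= total_payoff L act pick nu t)%E.
  apply: (@le_trans _ _ (\sum_(1 <= i < t.+2) ((phase_len t i)%:R * mustar mu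
      - 1188 * Y * phase_growth q t i)%:E)%E); last first.
    rewrite /total_payoff big_nat_cond [leRHS]big_nat_cond.
    by apply: lee_sum => i /andP[/andP[i0 _] _]; exact: bound.
  rewrite sumEFin lee_fin big_split /= sumrN -mulr_suml -mulr_sumr -natr_sum.
  (* The first t + 1 phases contain 2^(t+2) - 2 >= t rounds, so the lengths add up to [t]. *)
  rewrite sum_phase_len (minn_idPl _); last first.
    have : (t.+2 < 2 ^ t.+2)%N by exact: ltn_expl.
    by move=> /ltnW tp; rewrite leq_subRL ?(leq_trans _ tp)// add2n.
  rewrite lerD2l lerN2.
  have Y1 : 0 <= 1188 * Y by rewrite mulr_ge0 ?ler0n.
  by apply: le_trans (ler_wpM2l Y1 growth) _; lra.
rewrite /regret; apply: le_trans (leeB (lexx _) payoff_ge) _.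
by rewrite -EFinB lee_fin; lra.
Qed.

End phase_bound.

Theorem mainTheorem7 :
  forall R : realType, exists K : R, 0 < K /\
  forall (X : Type) (L : X -> X -> R) (mu : X -> R) (nu : X -> probability R R)
         (C d : R) (act pick : nat -> seq (event R X) -> X),
    is_metric L ->
    (forall x y, L x y <= 1) ->
    (forall x, 0 <= mu x <= 1) ->
    (forall x y, `|mu x - mu y| <= L x y) ->
    (forall x, nu x [set r | 0 <= r <= 1] = 1%E) ->
    (forall x, (\int[nu x]_(r in setT) r%:E = (mu x)%:E)%E) ->
    0 < C ->
    is_zooming_dim L mu C d ->
    act_valid L act ->
    pick_valid L act pick ->
    payoff_measurable L act pick nu ->
    forall t : nat, (2 <= t)%N ->
      (regret L mu act pick nu t <=
       (K * (C * ln t%:R) `^ (1 / (2 + d)) * t%:R `^ (1 - 1 / (2 + d)))%:E)%E.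
Proof.
move=> R; exists 9504; split; first by rewrite ltr0n.
move=> X L mu nu C d act pick metL diamL mu01 lipmu
  nu01 nu_mean C_gt0 [d_ge0 [coverC _]] actP pickP measV t t2.
exact: (regret_upper_bound metL diamL mu01 lipmu nu01 nu_mean C_gt0 d_ge0
  coverC actP pickP measV t2).
Qed.
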